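(* Let $\kappa=[2\ell-1]$ for some $\ell\in\mathbb Z$, let $t=F+\check E+\kappa K^{-1}\in\mathbf U$, and define for $a\ge0$ $$\dot t^{(2a)}=\frac{1}{[2a]!}\prod_{j=-a+1}^{a}\bigl(t-[2j-1]\bigr),\qquad \dot t^{(2a+1)}=\frac{t}{[2a+1]!}\prod_{j=-a+1}^{a}\bigl(t-[2j-1]\bigr).$$ Then for every $m\ge0$, in $\mathbf U$, $$\dot t^{(2m)}=\sum_{b=0}^{2m}\sum_{a=0}^{b}\sum_{c\ge0} q^{\binom{2c}{2}+2c-b(2m-b-2c)-a(b-a)}\,\mathfrak p^{(2m-b-2c)}(\kappa)\;\check E^{(a)}\begin{bmatrix}h;1-m\\ c\end{bmatrix}K^{b-2m+2c}F^{(b-a)},$$ $$\dot t^{(2m+1)}=\sum_{b=0}^{2m+1}\sum_{a=0}^{b}\sum_{c\ge0} q^{\binom{2c}{2}-b(2m-b-2c+1)-a(b-a)}\,\mathfrak p^{(2m-b-2c+1)}(\kappa)\;\check E^{(a)}\begin{bmatrix}h;1-m\\ c\end{bmatrix}K^{b-2m+2c-1}F^{(b-a)}.$$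
   Context: $q$ is an indeterminate, $[n]=\frac{q^n-q^{-n}}{q-q^{-1}}$ for $n\in\mathbb Z$, $[n]!=[1]\cdots[n]$, $[0]!=1$. $\mathbf U$ is the $\mathbb Q(q)$-algebra generated by $E,F,K^{\pm1}$ with relations $KK^{-1}=K^{-1}K=1$, $EF-FE=\frac{K-K^{-1}}{q-q^{-1}}$, $KE=q^2EK$, $KF=q^{-2}FK$. Put $\check E=q^{-1}EK^{-1}$, $\check E^{(n)}=\check E^n/[n]!$, $F^{(n)}=F^n/[n]!$. For $a\in\mathbb Z$, $n\in\mathbb N$: $\begin{bmatrix}h;a\\ n\end{bmatrix}=\prod_{i=1}^{n}\frac{q^{4a+4i-4}K^{-2}-1}{q^{4i}-1}$ (equal to $1$ for $n=0$). The polynomials $\mathfrak p_n(x)$ are defined by $\mathfrak p_0=1$, $\mathfrak p_n=0$ for $n<0$, $\mathfrak p_{n+1}=x\,\mathfrak p_n+q^{2-2n}[n][n-2]\,\mathfrak p_{n-1}$ ($n\ge0$); $\mathfrak p^{(n)}=\mathfrak p_n/[n]!$ for $n\ge0$ and $\mathfrak p^{(n)}=0$ for $n<0$. *)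

(* Defs.v *)
From HB Require Import structures.
From mathcomp Require Import all_boot all_order all_algebra.
Set Implicit Arguments. Unset Strict Implicit. Unset Printing Implicit Defensive.
Import Order.TTheory GRing.Theory Num.Theory.
Local Open Scope ring_scope.

Definition QQq : fieldType := {fraction {poly rat}}.
Definition qq : QQq := (FracField.tofrac ('X : {poly rat})).

Definition U_qint (n : int) : QQq := (qq ^ n - qq ^ (- n)) / (qq - qq^-1).

Definition U_qfact (n : nat) : QQq := \prod_(i < n) U_qint (i.+1)%:Z.

Fixpoint U_pqpair (n : nat) : {poly QQq} * {poly QQq} :=
  match n with
  | 0 => (1, 'X)
  | n'.+1 => let (a, b) := U_pqpair n' in
      (b, 'X * b + (qq ^ (2 - 2 * (n'.+1)%:Z) * U_qint (n'.+1)%:Z * U_qint (n'%:Z - 1)) *: a)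
  end.

Definition U_pq (n : nat) : {poly QQq} := (U_pqpair n).1.

Definition U_pdiv (n : int) (x : QQq) : QQq :=
  match n with
  | Posz k => (U_pq k).[x] / U_qfact k
  | Negz _ => 0
  end.

Section AlgDefs.
Variable A : algType QQq.

Definition U_zpowK (K Ki : A) (z : int) : A :=
  match z with
  | Posz n => K ^+ n
  | Negz n => Ki ^+ n.+1
  end.

Definition U_dpow (x : A) (n : nat) : A := (U_qfact n)^-1 *: x ^+ n.

Definition U_hbin (Ki : A) (a : int) (n : nat) : A :=
  \prod_(i < n) ((qq ^ (4 * (i.+1)%:Z) - 1)^-1 *:
                 (qq ^ (4 * a + 4 * (i.+1)%:Z - 4) *: Ki ^+ 2 - 1)).

(* prod_{j=-a+1}^{a} (t - [2j-1]) ; the index i < 2a corresponds to j = i - a + 1 *)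
Definition U_tprod (t : A) (a : nat) : A :=
  \prod_(i < (2 * a)%N) (t - (U_qint (2 * ((i%:Z) - a%:Z + 1) - 1))%:A).

Definition U_tdot_even (t : A) (a : nat) : A := (U_qfact (2 * a))^-1 *: U_tprod t a.
Definition U_tdot_odd (t : A) (a : nat) : A := (U_qfact (2 * a).+1)^-1 *: (t * U_tprod t a).

End AlgDefs.

(* Main.v *)
(** Multiplying by [t] gives [t * tdot_(2m) = [2m+1] tdot_(2m+1)] and
    [t * tdot_(2m+1) = [2m+2] tdot_(2m+2) + [2m+1] tdot_(2m)], so it is enough that the
    right-hand sides obey the same recursion.  Put [t] times the right-hand side back in the
    order Ec, Ki, F, and use the recursion of the polynomials p to trade [kappa * p^(k)] for
    [p^(k+1)] and [p^(k-1)].  The coefficient of [Ec^(a) _ K^z F^(d)] for a given index c then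
    only involves
      X = [h;1-m, c],  Y = [h;-m, c],  Z = [h;1-m, c-1]  and  Ki^2 Z.
    As Z = X - q^(4c) Y and Ki^2 Z = q^(4m) (X - Y), everything reduces to the vanishing of
    the coefficients of X and of Y, which are identities of rational functions in
    q, q^a, q^c, q^d, q^m. *)

Require Import Defs.
From HB Require Import structures.
From mathcomp Require Import all_boot all_order all_algebra.
From mathcomp Require Import ring zify.
Import Order.TTheory GRing.Theory Num.Theory.
Local Open Scope ring_scope.

(* Exponent of q in the expansion, with s = 1 for even n and s = -1 for odd n; here b = a + d,
   and 2c^2 - c is 'C(2c, 2). *)
Definition expo (s n a d c : int) : int :=
  2 * c * c + s * c - (a + d) * (n - (a + d) - 2 * c) - a * d.

(** * Scalar identities between powers of q *)

Section Scalar.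
Variables (R : fieldType) (q : R).
Hypotheses (q_neq0 : q != 0) (q2_neq1 : q ^+ 2 - 1 != 0).
Let qi (n : int) : R := (q ^ n - q ^ (- n)) / (q - q^-1).

Lemma expz_natl (k : nat) (x : int) : q ^ (k%:R * x) = (q ^ x) ^+ k.
Proof. by rewrite exprnP exprz_exp mulrC natz. Qed.

Lemma expz_nat (k : nat) : q ^ (k%:R : int) = q ^+ k.
Proof. by rewrite exprnP natz. Qed.

Lemma expzN (x : int) : q ^ (- x) = (q ^ x)^-1.
Proof. by rewrite invr_expz. Qed.

Lemma qdiff_neq0 : q - q^-1 != 0.
Proof.
apply: contra_neq q2_neq1 => h.
by rewrite -(mulfV q_neq0) expr2 -mulrBr h mulr0.
Qed.

Lemma expzD (x y : int) : q ^ (x + y) = q ^ x * q ^ y.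
Proof. by rewrite expfzDr. Qed.

Definition qnorm := (mulNr, expzD, expz_natl, expr1z, expz_nat, expzN).

Variables (s n a d c : int).
Let e := q ^ expo s n a d c.

(** Shifting an index changes the quadratic exponent [expo] by a linear form only. Hence every
    coefficient below is the common factor [e] times a rational function of q, q^a, q^d, q^c and
    q^n. *)
Lemma expo_pred_a : q ^ expo s n (a - 1) d c = e * q ^ (n + 1 - 2 * a - d - 2 * c).
Proof. by rewrite -expzD; congr (q ^ _); rewrite /expo; ring. Qed.

Lemma expo_pred_d : q ^ expo s n a (d - 1) c = e * q ^ (n + 1 - a - 2 * d - 2 * c).
Proof. by rewrite -expzD; congr (q ^ _); rewrite /expo; ring. Qed.

Lemma expo_pred_c : q ^ expo s n a d (c - 1) = e * q ^ (2 - s - 4 * c - 2 * a - 2 * d).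
Proof. by rewrite -expzD; congr (q ^ _); rewrite /expo; ring. Qed.

Lemma expo_succ_a_pred_c : q ^ expo s n (a + 1) d (c - 1) = e * q ^ (1 - s - n - 2 * c - d).
Proof. by rewrite -expzD; congr (q ^ _); rewrite /expo; ring. Qed.

(* Coefficients of X, Y, Ki^2 Z and Z in the product of t with the expansion of index n. *)
Definition prod_coefX : R := qi a * q ^ expo s n (a - 1) d c
  + q ^ (- 2 * a) * q ^ expo s n a d c * qi (n + 1 - a - d - 2 * c).

Definition prod_coefY : R :=
  qi d * q ^ (- 2 * a + 2 * (a + d + 2 * c - n - 1)) * q ^ expo s n a (d - 1) c.

Definition prod_coefW : R := (q ^+ 2 - 1)^-1 * q ^ (- 3 * a) * q ^ expo s n (a + 1) d (c - 1)
  - q ^ (- 2 * a) * q ^ expo s n a d (c - 1) * q ^ (2 - 2 * (n - a - d - 2 * c + 2))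
    * qi (n - a - d - 2 * c).

Definition prod_coefZ : R := - ((q ^+ 2 - 1)^-1 * q ^ (- a) * q ^ expo s n (a + 1) d (c - 1)).

End Scalar.

Arguments prod_coefX {R} q s n a d c.
Arguments prod_coefY {R} q s n a d c.
Arguments prod_coefW {R} q s n a d c.
Arguments prod_coefZ {R} q s n a d c.

Section ScalarIdentities.
Variables (R : fieldType) (q : R).
Hypotheses (q_neq0 : q != 0) (q2_neq1 : q ^+ 2 - 1 != 0).
Let qi (n : int) : R := (q ^ n - q ^ (- n)) / (q - q^-1).
Variables a d c m : int.

(** After the common power [e] is extracted, q^a, q^d, q^c and q^m become independent nonzero
    variables, so that the goal is an identity of rational functions. *)
Ltac qfield :=
  rewrite /prod_coefX /prod_coefY /prod_coefW /prod_coefZ /qi ?expo_succ_a_pred_c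
    ?expo_pred_a ?expo_pred_d ?expo_pred_c //;
  let e := fresh "e" in
  set e := q ^ expo _ _ _ _ _;
  (have : e != 0; first exact: expfz_neq0);
  move: (expfz_neq0 a q_neq0) (expfz_neq0 d q_neq0) (expfz_neq0 c q_neq0)
        (expfz_neq0 m q_neq0) (qdiff_neq0 _ q q_neq0 q2_neq1);
  rewrite !qnorm //;
  move: e (q ^ a) (q ^ d) (q ^ c) (q ^ m) => e A D C M A0 D0 C0 M0 qd e0;
  field; repeat (apply/andP; split); (assumption || exact: oner_neq0).

(** Coefficient of X after Z and [Ki^2] Z are expressed through X and Y. The right-hand side is the
    coefficient in the odd expansion of index 2m+1, which has the same parameter 1-m and so involves
    X only; [even_coefY] is the matching cancellation of Y. *)
Lemma even_coefX (n := 2 * m) :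
  prod_coefX q 1 n a d c + q ^ (4 * m) * prod_coefW q 1 n a d c + prod_coefZ q 1 n a d c
  = qi (n + 1) * q ^ expo (-1) (n + 1) a d c.
Proof.
have -> : q ^ expo (-1) (n + 1) a d c = q ^ expo 1 n a d c * q ^ (- a - d - 2 * c).
  by rewrite -expzD //; congr (q ^ _); rewrite /expo; ring.
rewrite /n; qfield.
Qed.

Lemma even_coefY (n := 2 * m) :
  prod_coefY q 1 n a d c - q ^ (4 * m) * prod_coefW q 1 n a d c
  - q ^ (4 * c) * prod_coefZ q 1 n a d c = 0.
Proof. rewrite /n; qfield. Qed.

(** Here the target has two parts: the even expansion of index 2m+2, whose parameter -m gives Y, and
    that of index 2m with c shifted, which gives Z = X - q^(4c) Y. Only the second contributes to X;
    both contribute to Y in [odd_coefY]. *)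
Lemma odd_coefX (n := 2 * m + 1) :
  prod_coefX q (-1) n a d c + q ^ (4 * m) * prod_coefW q (-1) n a d c + prod_coefZ q (-1) n a d c
  = qi n * q ^ expo 1 (n - 1) a d (c - 1).
Proof.
have -> : q ^ expo 1 (n - 1) a d (c - 1) = q ^ expo (-1) n a d c * q ^ (1 - 2 * c - a - d).
  by rewrite -expzD //; congr (q ^ _); rewrite /expo; ring.
rewrite /n; qfield.
Qed.

Lemma odd_coefY (n := 2 * m + 1) :
  prod_coefY q (-1) n a d c - q ^ (4 * m) * prod_coefW q (-1) n a d c
  - q ^ (4 * c) * prod_coefZ q (-1) n a d c
  = qi (n + 1) * q ^ expo 1 (n + 1) a d c
    - q ^ (4 * c) * (qi n * q ^ expo 1 (n - 1) a d (c - 1)).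
Proof.
have -> : q ^ expo 1 (n - 1) a d (c - 1) = q ^ expo (-1) n a d c * q ^ (1 - 2 * c - a - d).
  by rewrite -expzD //; congr (q ^ _); rewrite /expo; ring.
have -> : q ^ expo 1 (n + 1) a d c = q ^ expo (-1) n a d c * q ^ (2 * c - a - d).
  by rewrite -expzD //; congr (q ^ _); rewrite /expo; ring.
rewrite /n; qfield.
Qed.

End ScalarIdentities.

(** * Quantum integers and the recursion of the divided polynomials p *)

Lemma qq_neq0 : qq != 0.
Proof. by rewrite /qq tofrac_eq0 polyX_eq0. Qed.

Lemma qq_expr_neq1 (k : nat) : qq ^+ k.+1 - 1 != 0.
Proof.
rewrite /qq -tofracXn -tofrac1 -tofracB tofrac_eq0 subr_eq0.
by apply/eqP => /(congr1 (size : {poly rat} -> nat)); rewrite size_polyXn size_poly1.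
Qed.

(** A zero of [n] would give q^n = q^(-n), that is q^(2n) = 1. *)
Lemma qint_neq0 (R : fieldType) (q : R) (n : nat) :
  q != 0 -> q ^+ 2 - 1 != 0 -> q ^+ (n + n) - 1 != 0 ->
  (q ^ n%:Z - q ^ (- n%:Z)) / (q - q^-1) != 0.
Proof.
move=> q0 q2 qn; rewrite mulf_neq0 ?invr_neq0 ?qdiff_neq0 //.
have qn0 : q ^+ n != 0 by rewrite expf_neq0.
by apply: contra_neq qn; rewrite expzN -exprnP => h; rewrite exprD -(mulfV qn0) -mulrBr h mulr0.
Qed.

Lemma U_qint_neq0 (k : nat) : U_qint k.+1%:Z != 0.
Proof. exact: (qint_neq0 _ _ k.+1 qq_neq0 (qq_expr_neq1 1) (qq_expr_neq1 (k + k.+1))). Qed.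

Lemma U_qint0 : U_qint 0 = 0.
Proof. by rewrite /U_qint oppr0 subrr mul0r. Qed.

Lemma U_qfactS (n : nat) : U_qfact n.+1 = U_qfact n * U_qint n.+1%:Z.
Proof. by rewrite /U_qfact big_ord_recr. Qed.

Lemma U_qfact_neq0 (n : nat) : U_qfact n != 0.
Proof. by apply/prodf_neq0 => i _; apply: U_qint_neq0. Qed.

Lemma U_pqS (n : nat) :
  U_pq n.+2 = 'X * U_pq n.+1
    + (qq ^ (2 - 2 * n.+1%:Z) * U_qint n.+1%:Z * U_qint (n%:Z - 1)) *: U_pq n.
Proof. by rewrite /U_pq /=; case: (U_pqpair n). Qed.

(** The generic step of [U_pdiv_rec], with [f] = [n]!, [i] = [n+1], [j] = [n+2], [k] = [n-1], and
    [p], [r] the values of the polynomials of index n+1 and n. *)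
Lemma pdiv_rec_field (R : fieldType) (f i j k w p r x : R) :
  f != 0 -> i != 0 -> j != 0 ->
  x * (p / (f * i)) = j * ((x * p + w * i * k * r) / (f * i * j)) - w * k * (r / f).
Proof. by move=> f0 i0 j0; field; rewrite f0 i0 j0. Qed.

(** The defining recursion divided by [k]!. It extends to every integer [k]: at [k] = -1 the nonzero
    value of index 0 on the right is killed by [0]. *)
Lemma U_pdiv_rec (k : int) (x : QQq) :
  x * U_pdiv k x = U_qint (k + 1) * U_pdiv (k + 1) x
    - qq ^ (2 - 2 * k) * U_qint (k - 2) * U_pdiv (k - 1) x.
Proof.
case: k => [[|n]|[|n]].
- rewrite /= /U_pq /= /U_qfact big_ord0 big_ord1 hornerX hornerC /= mulr0 subr0.
  by rewrite invr1 !mulr1 [_ * (x / _)]mulrC divfK // U_qint_neq0.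
- have -> : n.+1%:Z + 1 = n.+2 by lia.
  have -> : n.+1%:Z - 1 = n by lia.
  have -> : n.+1%:Z - 2 = n%:Z - 1 by lia.
  rewrite /U_pdiv U_pqS hornerD hornerM hornerX hornerZ !U_qfactS.
  exact: pdiv_rec_field (U_qfact_neq0 n) (U_qint_neq0 n) (U_qint_neq0 n.+1).
- by rewrite /= U_qint0 mul0r !mulr0 subr0.
- by rewrite /= !mulr0 subr0.
Qed.

Lemma U_pdiv0 (x : QQq) : U_pdiv 0 x = 1.
Proof. by rewrite /= /U_qfact big_ord0 hornerC divr1. Qed.

(** The inductive steps for the coefficients of [Ki^2] and of 1 that arise when F passes a power of
    [Ec]. *)
Lemma F_Ec_expr_coefs (R : fieldType) (q : R) (a : nat) : q != 0 -> q ^+ 2 - 1 != 0 ->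
  let qi (n : int) := (q ^ n - q ^ (- n)) / (q - q^-1) in
  qi a%:Z * q ^ (- 3 * a%:Z + 3) * q ^- 4 + q ^ (- 2 * a%:Z) = qi a.+1%:Z * q ^ (- 3 * a%:Z)
  /\ qi a%:Z * q ^ (1 - a%:Z) + q ^ (- 2 * a%:Z) = qi a.+1%:Z * q ^ (- a%:Z).
Proof.
move=> q0 q2 qi; rewrite /qi.
have -> : a.+1%:Z = a%:Z + 1 by lia.
move: (expfz_neq0 a%:Z q0) (qdiff_neq0 _ _ q0 q2).
rewrite !qnorm //; move: (q ^ a%:Z) => A A0 qd.
split; field; repeat (apply/andP; split); assumption.
Qed.

(** * Commutation relations between F, [Ec], K and its inverse *)

Section Relations.
Variables (R : fieldType) (q : R).
Hypotheses (q_neq0 : q != 0) (q_nroot : forall k : nat, q ^+ k.+1 - 1 != 0).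
Let qi (n : int) : R := (q ^ n - q ^ (- n)) / (q - q^-1).
Variables (A : algType R) (E F K Ki : A).
Hypotheses (KKi : K * Ki = 1) (KiK : Ki * K = 1)
  (EF : E * F - F * E = (q - q^-1)^-1 *: (K - Ki))
  (KE : K * E = q ^+ 2 *: (E * K)) (KF : K * F = q ^- 2 *: (F * K)).
Let Ec := q^-1 *: (E * Ki).

Lemma qX_neq0 (n : nat) : q ^+ n != 0.
Proof. exact: expf_neq0 q_neq0. Qed.

Lemma F_K : F * K = q ^+ 2 *: (K * F).
Proof. by rewrite KF scalerA mulfV ?qX_neq0 // scale1r. Qed.

Lemma F_Ki : F * Ki = q ^- 2 *: (Ki * F).
Proof.
have -> : Ki * F = Ki * (F * K) * Ki by rewrite -!mulrA KKi mulr1.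
rewrite F_K -scalerAr -scalerAl mulrA KiK mul1r scalerA.
by rewrite mulVf ?qX_neq0 // scale1r.
Qed.

Lemma Ki_E : Ki * E = q ^- 2 *: (E * Ki).
Proof.
have -> : E * Ki = Ki * (K * E) * Ki by rewrite mulrA KiK mul1r.
by rewrite KE -scalerAr -scalerAl scalerA mulVf ?qX_neq0 // scale1r -!mulrA KKi mulr1.
Qed.

Lemma Ki_Ec : Ki * Ec = q ^- 2 *: (Ec * Ki).
Proof. by rewrite /Ec -scalerAr mulrA Ki_E -!scalerAl scalerA mulrC -scalerA. Qed.

(** The commutator of E and F, multiplied by [Ki] on the right, turns [K - Ki] into [1 - Ki^2], and
    q^-1/(q - q^-1) = 1/(q^2 - 1). *)
Lemma F_Ec : F * Ec = q ^- 2 *: (Ec * F) + (q ^+ 2 - 1)^-1 *: (Ki ^+ 2 - 1).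
Proof.
have FE : F * E = E * F - (q - q^-1)^-1 *: (K - Ki) by rewrite -EF opprB addrC subrK.
rewrite /Ec -scalerAr mulrA FE mulrBl -mulrA F_Ki -scalerAr -scalerAl mulrBl KKi -expr2.
rewrite scalerBr !scalerA mulrC; congr (_ + _).
  by rewrite -scalerAl scalerA mulrA.
rewrite -scalerN opprB; congr (_ *: _); rewrite -invfM; congr (_^-1).
by rewrite mulrBr mulfV // expr2.
Qed.

End Relations.

(** * Triple sums over a cube, and their index shifts *)

Section TripleSum.
Variables (M : zmodType) (B : nat).

(** A cube is used instead of the triangle a <= b because its three indices can be shifted
    independently; the summands vanish outside the wanted range. *)
Definition sum3 (f : nat -> nat -> nat -> M) : M :=
  \sum_(a < B) \sum_(d < B) \sum_(c < B) f a d c.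

Lemma eq_sum3 (f g : nat -> nat -> nat -> M) :
  (forall a d c, f a d c = g a d c) -> sum3 f = sum3 g.
Proof. by move=> fg; do 3!apply: eq_bigr => ? _; apply: fg. Qed.

Lemma sum3D (f g : nat -> nat -> nat -> M) :
  sum3 (fun a d c => f a d c + g a d c) = sum3 f + sum3 g.
Proof.
rewrite /sum3 -big_split; apply: eq_bigr => a _.
by rewrite -big_split; apply: eq_bigr => d _; rewrite big_split.
Qed.

Lemma sum_shift (f : nat -> M) : f 0%N = 0 -> f B = 0 -> \sum_(i < B) f i.+1 = \sum_(i < B) f i.
Proof.
move=> f0 fB; transitivity (\sum_(i < B.+1) f i); first by rewrite big_ord_recl f0 add0r.
by rewrite big_ord_recr /= fB addr0.
Qed.

Lemma sum3_shift_a (f : nat -> nat -> nat -> M) :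
  (forall d c, f 0%N d c = 0) -> (forall d c, f B d c = 0) ->
  sum3 (fun a d c => f a.+1 d c) = sum3 f.
Proof.
move=> f0 fB.
by apply: (sum_shift (fun a => \sum_(d < B) \sum_(c < B) f a d c));
  do 2!apply: big1 => ? _.
Qed.

Lemma sum3_shift_d (f : nat -> nat -> nat -> M) :
  (forall a c, f a 0%N c = 0) -> (forall a c, f a B c = 0) ->
  sum3 (fun a d c => f a d.+1 c) = sum3 f.
Proof.
move=> f0 fB; apply: eq_bigr => a _.
by apply: (sum_shift (fun d => \sum_(c < B) f a d c)); apply: big1 => ? _.
Qed.

Lemma sum3_shift_c (f : nat -> nat -> nat -> M) :
  (forall a d, f a d 0%N = 0) -> (forall a d, f a d B = 0) ->
  sum3 (fun a d c => f a d c.+1) = sum3 f.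
Proof.
move=> f0 fB; do 2!apply: eq_bigr => ? _.
by apply: (sum_shift (fun c => f _ _ c)).
Qed.

(** Substitution b = a + d, followed by an exchange of the sums over a and b. *)
Lemma sum3_triangle (C : nat) (f : nat -> nat -> nat -> M) : (C <= B)%N ->
  (forall a d c, (B <= a + d)%N || (C <= c)%N -> f a d c = 0) ->
  sum3 f = \sum_(b < B) \sum_(a < b.+1) \sum_(c < C) f a (b - a)%N c.
Proof.
move=> CB f0.
pose g a d := \sum_(c < C) f a d c.
have -> : sum3 f = \sum_(a < B) \sum_(d < B) g a d.
  do 2!apply: eq_bigr => ? _; rewrite [RHS](big_ord_widen _ _ CB) [RHS]big_mkcond.
  by apply: eq_bigr => c _; case: ltnP => // h; apply: f0; rewrite h orbT.
have -> : \sum_(b < B) \sum_(a < b.+1) \sum_(c < C) f a (b - a)%N c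
    = \sum_(b < B) \sum_(a < B | (a <= b)%N) g a (b - a)%N.
  by apply: eq_bigr => b _; rewrite (big_ord_widen B (fun a => g a (b - a)%N)).
rewrite [RHS](exchange_big_dep xpredT) //=; apply: eq_bigr => a _.
rewrite -(big_mkord (fun b => (a <= b)%N) (fun b => g a (b - a)%N)) -(big_mkord xpredT (g a)).
(* The range of b is cut at a. Below the cut the condition [a <= b] fails; above it, d = b - a runs
   up to [B - a], beyond which [f] vanishes. *)
rewrite [RHS](@big_cat_nat _ _ _ a) //=; last exact: ltnW.
have -> : \sum_(0 <= i < a | (a <= i)%N) g a (i - a)%N = 0.
  by rewrite big_nat_cond big_pred0 // => i; apply/negbTE; lia.
have -> : \sum_(a <= i < B | (a <= i)%N) g a (i - a)%N = \sum_(a <= i < B) g a (i - a)%N.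
  by rewrite big_nat_cond [RHS]big_nat_cond; apply: eq_bigl => i; lia.
rewrite add0r -{2}[nat_of_ord a]add0n [RHS]big_addn.
have g0 : \sum_(B - a <= d < B) g a d = 0.
  rewrite big_nat_cond; apply: big1 => d /andP[/andP[h _] _].
  by apply: big1 => c _; apply: f0; rewrite -leq_subLR h.
rewrite [LHS](@big_cat_nat _ _ _ (B - a)) ?leq_subr //= g0 addr0.
by apply: eq_bigr => d _; rewrite addnK.
Qed.

End TripleSum.

(** Here [v1], [v4], [v3], [v2] carry X, Y, [Ki^2] Z and Z. The term [k3] is the one subtracted in
    [Ki_expansion], moved to the other side. *)
Lemma collect_terms (R : fieldType) (M : lmodType R) (y w e x3 x2 k1 k2 k3 : R)
    (v1 v2 v3 v4 : M) :
  y *: v4 + (w * e) *: (x3 *: v3 - x2 *: v2) + k1 *: v1 + k2 *: v1 =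
  (k1 + k2) *: v1 + y *: v4 + (w * x3 * e - k3) *: v3 + (- (w * x2 * e)) *: v2 + k3 *: v3.
Proof.
rewrite [RHS]addrAC -[X in X + _ *: v2]addrA -[(_ - k3) *: v3 + _]scalerDl.
by rewrite subrK scaleNr scalerBr !scalerA ![w * e * _]mulrAC -addrA -scalerDl [LHS]addrC !addrA.
Qed.

(** Elimination of [Ki^2] Z and Z, with [v1], [v2] carrying X, Y and with [k] = q^(4m), [l] =
    q^(4c). *)
Lemma eliminate_terms (R : fieldType) (M : lmodType R) (x y u z k l : R) (v1 v2 : M) :
  x *: v1 + y *: v2 + u *: (k *: (v1 - v2)) + z *: (v1 - l *: v2) =
  (x + k * u + z) *: v1 + (y - k * u - l * z) *: v2.
Proof.
rewrite !scalerBr !scalerA !scalerDl !scaleNr -!addrA ![u * k]mulrC [z * l]mulrC.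
rewrite !addrA; congr (_ - _); rewrite [LHS]addrAC; congr (_ - _).
by rewrite [X in X + _]addrAC addrAC.
Qed.

(** * Moving F and [Ki] past powers of the generators *)

Section NormalOrder.
Variables (R : fieldType) (q : R).
Hypotheses (q_neq0 : q != 0) (q_nroot : forall k : nat, q ^+ k.+1 - 1 != 0).
Let qi (n : int) : R := (q ^ n - q ^ (- n)) / (q - q^-1).
Let w : R := (q ^+ 2 - 1)^-1.
Variables (A : algType R) (Ec F K Ki : A).
Hypotheses (KiK : Ki * K = 1) (F_K : F * K = q ^+ 2 *: (K * F))
  (F_Ki : F * Ki = q ^- 2 *: (Ki * F)) (Ki_Ec : Ki * Ec = q ^- 2 *: (Ec * Ki))
  (F_Ec : F * Ec = q ^- 2 *: (Ec * F) + w *: (Ki ^+ 2 - 1)).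

Definition zpowK (z : int) : A := match z with Posz n => K ^+ n | Negz n => Ki ^+ n.+1 end.

Lemma Ki_zpowK (z : int) : Ki * zpowK z = zpowK (z - 1).
Proof.
case: z => [[|n]|n].
- by rewrite /zpowK /= expr0 mulr1.
- have -> : n.+1%:Z - 1 = n by lia.
  by rewrite /zpowK /= exprS mulrA KiK mul1r.
- have -> : Negz n - 1 = Negz n.+1 by lia.
  by rewrite /zpowK /= -exprS.
Qed.

Lemma F_zpowK (z : int) : F * zpowK z = q ^ (2 * z) *: (zpowK z * F).
Proof.
have comX (x : A) (c : R) n : F * x = c *: (x * F) -> F * x ^+ n = c ^+ n *: (x ^+ n * F).
  move=> Fx; elim: n => [|n IH]; first by rewrite !expr0 scale1r mulr1 mul1r.
  by rewrite exprS mulrA Fx -scalerAl -(mulrA x F) IH -scalerAr scalerA mulrA -!exprS.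
rewrite expz_natl.
case: z => n; rewrite /zpowK /=.
- by rewrite (comX _ _ n F_K) -exprnP exprAC.
- by rewrite (comX _ _ n.+1 F_Ki) NegzE expzN -exprnP -!exprVn exprAC.
Qed.

Lemma Ki_Ec_expr (a : nat) : Ki * Ec ^+ a = q ^ (- 2 * a%:Z) *: (Ec ^+ a * Ki).
Proof.
have -> : q ^ (- 2 * a%:Z) = (q ^- 2) ^+ a by rewrite mulNr expzN expz_natl -exprnP exprAC exprVn.
elim: a => [|n IH]; first by rewrite !expr0 scale1r mulr1 mul1r.
by rewrite exprSr mulrA IH -scalerAl -(mulrA _ Ki) Ki_Ec -scalerAr scalerA mulrA -!exprSr.
Qed.

(** Induction on [a]: each further factor [Ec] contributes a new [Ki^2 - 1], while the earlier
    [Ki^2] passes it at the cost of q^-4. *)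
Lemma F_Ec_expr (a : nat) :
  F * Ec ^+ a.+1 = q ^ (- 2 * a.+1%:Z) *: (Ec ^+ a.+1 * F)
   + (w * qi a.+1%:Z) *: (Ec ^+ a * (q ^ (- 3 * a%:Z) *: Ki ^+ 2 - q ^ (- a%:Z) *: 1)).
Proof.
have KiKi_Ec : Ki ^+ 2 * Ec = q ^- 4 *: (Ec * Ki ^+ 2).
  rewrite expr2 -(mulrA Ki Ki) Ki_Ec -scalerAr (mulrA Ki Ec) Ki_Ec -scalerAl scalerA.
  by rewrite -mulrA -invfM -exprD.
elim: a => [|a IH].
  rewrite !expr1 expr0 mul1r F_Ec; congr (_ *: _ + _ *: _).
    by rewrite /qi expzN !expr1z mulfV ?mulr1 // qdiff_neq0.
  by rewrite !mulr0 expr0z !scale1r.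
have [h1 h2] := F_Ec_expr_coefs R q a.+1 q_neq0 (q_nroot 1).
rewrite exprSr mulrA IH mulrDl -!scalerAl -!mulrA F_Ec.
rewrite mulrBl -!scalerAl mul1r KiKi_Ec scalerA.
(* The scalar identities are taken at [a.+1], so their exponents are brought back to [a]. *)
have h3 : q ^ (- 3 * a.+1%:Z + 3) = q ^ (- 3 * a%:Z) by congr (q ^ _); lia.
have h4 : q ^ (1 - a.+1%:Z) = q ^ (- a%:Z) by congr (q ^ _); lia.
have h5 : q ^ (- 2 * a.+2%:Z) = q ^ (- 2 * a.+1%:Z) * q ^- 2.
  by rewrite -expz_nat -expzN -expzD //; congr (q ^ _); lia.
move: (Ki ^+ 2) h1 h2 => y; rewrite -!/(qi _); move: (qi _) (qi _) => k1 k2 h1 h2.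
rewrite !(scalerDr, mulrDr, scalerN, mulrN) -!scalerAr !mulr1 !mulrA -!exprSr.
rewrite !scalerA -addrA h5; congr (_ + _).
rewrite addrACA -opprD -!scalerDl; congr (_ *: _ - _ *: _).
  by rewrite -[RHS]mulrA -h1 h3 mulrDr [RHS]addrC; congr (_ + _); rewrite ?mulrA // mulrC.
by rewrite -[RHS]mulrA -h2 h4 mulrDr [RHS]addrC; congr (_ + _); rewrite ?mulrA // mulrC.
Qed.

(* These mirror U_qfact, U_dpow, U_hbin over an arbitrary field so that the theorem is an
   instance up to conversion: [field] is impractical on the concrete fraction field QQq. *)
Definition qfact (n : nat) : R := \prod_(i < n) qi (i.+1)%:Z.
Definition dpow (x : A) (n : nat) : A := (qfact n)^-1 *: x ^+ n.
Definition hbin (a : int) (n : nat) : A :=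
  \prod_(i < n) ((q ^ (4 * (i.+1)%:Z) - 1)^-1 *:
                 (q ^ (4 * a + 4 * (i.+1)%:Z - 4) *: Ki ^+ 2 - 1)).
(* The value 0 at c = 0 makes hbin_rec hold for every c. *)
Definition hprev (a : int) (c : nat) : A := if c is c'.+1 then hbin a c' else 0.

(** * Divided powers and the elements [h;a,n] *)

Lemma qi0 : qi 0 = 0.
Proof. by rewrite /qi oppr0 subrr mul0r. Qed.

Lemma qiS_neq0 (k : nat) : qi k.+1 != 0.
Proof. exact: (qint_neq0 R q k.+1 q_neq0 (q_nroot 1) (q_nroot (k + k.+1))). Qed.

Lemma qfactS (n : nat) : qfact n.+1 = qfact n * qi n.+1.
Proof. by rewrite /qfact big_ord_recr. Qed.

Lemma qfact_neq0 (n : nat) : qfact n != 0.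
Proof. by apply/prodf_neq0 => i _; apply: qiS_neq0. Qed.

Lemma dpowS (x : A) (n : nat) : x * dpow x n = qi n.+1 *: dpow x n.+1.
Proof.
rewrite /dpow -scalerAr -exprS scalerA qfactS invfM mulrCA.
by rewrite divff ?mulr1 // qiS_neq0.
Qed.

Lemma Ki_dpow (a : nat) : Ki * dpow Ec a = q ^ (- 2 * a%:Z) *: (dpow Ec a * Ki).
Proof. by rewrite /dpow -scalerAr Ki_Ec_expr -scalerAl !scalerA mulrC. Qed.

Definition F_dpow_lower (a : nat) : A :=
  if a is a'.+1 then dpow Ec a' * (w *: (q ^ (- 3 * a'%:Z) *: Ki ^+ 2 - q ^ (- a'%:Z) *: 1))
  else 0.

(** Division by [a]! absorbs the factor [a] of [F_Ec_expr] and leaves the divided power of order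
    a-1. *)
Lemma F_dpow (a : nat) :
  F * dpow Ec a = q ^ (- 2 * a%:Z) *: (dpow Ec a * F) + F_dpow_lower a.
Proof.
case: a => [|a].
  by rewrite addr0 mulr0 expr0z scale1r /dpow expr0 -scalerAr -scalerAl mulr1 mul1r.
rewrite /dpow -scalerAr F_Ec_expr scalerDr -scalerAl !scalerA mulrC; congr (_ + _).
rewrite /F_dpow_lower /dpow -scalerAr -scalerAl !scalerA qfactS; congr (_ *: _).
rewrite invfM mulrCA; congr (_ * _).
by rewrite mulrAC -mulrA mulfV ?mulr1 // qiS_neq0.
Qed.

Lemma hbin_comm (x : A) (a : int) (n : nat) :
  GRing.comm x Ki -> GRing.comm x (hbin a n).
Proof.
move=> xK; apply: commr_prod => i _; apply: commr_sym.
rewrite /GRing.comm -scalerAl -scalerAr; congr (_ *: _).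
rewrite mulrBr mulrBl mulr1 mul1r -scalerAl -scalerAr.
by have -> : x * Ki ^+ 2 = Ki ^+ 2 * x by apply: commrX.
Qed.

(** F passes [Ki^2] with the factor q^-4, and [a] enters only through q^(4a) [Ki^2]. This is the
    source of Y. *)
Lemma F_hbin (a : int) (n : nat) : F * hbin a n = hbin (a - 1) n * F.
Proof.
rewrite /hbin; elim: n => [|n IH]; first by rewrite !big_ord0 mulr1 mul1r.
rewrite !big_ord_recr /= mulrA IH -!mulrA; congr (_ * _).
rewrite -scalerAr -scalerAl; congr (_ *: _).
rewrite mulrBr mulrBl mulr1 mul1r -scalerAr -scalerAl; congr (_ - _).
have -> : F * Ki ^+ 2 = q ^- 4 *: (Ki ^+ 2 * F).
  rewrite expr2 (mulrA F Ki) F_Ki -scalerAl -(mulrA Ki F) F_Ki -scalerAr scalerA mulrA.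
  by rewrite -invfM -exprD.
rewrite scalerA; congr (_ *: _).
by rewrite -expz_nat -expzN -expzD //; congr (q ^ _); lia.
Qed.

(** For c > 0 let H be the numerator of Z. The numerator of X is H times its last factor q^(4c-4m)
    [Ki^2] - 1, that of Y is H times its first factor q^(-4m) [Ki^2] - 1. Both claims then compare
    coefficients of [Ki^2] H and H. *)
Lemma hbin_rec (m c : nat) :
  hprev (1 - m%:Z) c = hbin (1 - m%:Z) c - q ^ (4 * c%:Z) *: hbin (- m%:Z) c /\
  Ki ^+ 2 * hprev (1 - m%:Z) c = q ^ (4 * m%:Z) *: (hbin (1 - m%:Z) c - hbin (- m%:Z) c).
Proof.
case: c => [|c].
  by rewrite /hprev /hbin !big_ord0 mulr0 expr0z scale1r subrr scaler0 mulr0.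
pose hnum (a : int) n := \prod_(i < n) (q ^ (4 * a + 4 * (i.+1)%:Z - 4) *: Ki ^+ 2 - 1).
pose hden n : R := \prod_(i < n) (q ^ (4 * (i.+1)%:Z) - 1)^-1.
have hE a n : hbin a n = hden n *: hnum a n by rewrite /hbin scaler_prod.
set H := hnum (1 - m%:Z) c.
have KH : H * Ki ^+ 2 = Ki ^+ 2 * H.
  rewrite /H; apply: commr_sym; apply: commr_prod => i _.
  by rewrite /GRing.comm mulrBr mulrBl mulr1 mul1r -scalerAl -scalerAr.
have den0 : q ^ (4 * (c.+1)%:Z) - 1 != 0.
  by rewrite expz_natl -exprnP -exprM -[(_ * 4)%N]prednK ?muln_gt0.
have hX : hnum (1 - m%:Z) c.+1 = (q ^ (4 * c.+1%:Z - 4 * m%:Z)) *: (Ki ^+ 2 * H) - H.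
  rewrite /hnum big_ord_recr -/(hnum _ _) /= -/H mulrBr mulr1 -scalerAr KH.
  by congr (q ^ _ *: _ - _); lia.
have hY : hnum (- m%:Z) c.+1 = (q ^ (- 4 * m%:Z)) *: (Ki ^+ 2 * H) - H.
  rewrite /hnum big_ord_recl /= mulrBl mul1r -scalerAl.
  have -> : \prod_(i < c) (q ^ (4 * (- m%:Z) + 4 * (lift ord0 i).+1%:Z - 4) *: Ki ^+ 2 - 1) = H.
    apply: eq_bigr => i _; rewrite lift0; congr (q ^ _ *: _ - _); lia.
  by congr (q ^ _ *: _ - _); lia.
have dS : hden c.+1 = hden c / (q ^ (4 * (c.+1)%:Z) - 1) by rewrite /hden big_ord_recr.
rewrite /hprev !hE hX hY -/H dS -scalerAr.
have -> : q ^ (4 * c.+1%:Z - 4 * m%:Z) = q ^ (4 * c.+1%:Z) / q ^ (4 * m%:Z).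
  by rewrite expzD // expzN.
have -> : q ^ (- 4 * m%:Z) = (q ^ (4 * m%:Z))^-1 by rewrite mulNr expzN.
move: (Ki ^+ 2 * H) (hden c) (expfz_neq0 (4 * m%:Z) q_neq0) den0 => v h.
move: (q ^ (4 * m%:Z)) (q ^ (4 * c.+1%:Z)) => M C M0 C1.
split.
  rewrite !scalerBr !scalerA opprB.
  have -> : C * (h / (C - 1)) / M = h / (C - 1) * (C / M) by field; rewrite C1 M0.
  rewrite [RHS]addrC addrA subrK -scalerBl; congr (_ *: _).
  by field.
rewrite -scalerBr opprB addrA subrK -scalerBl !scalerA; congr (_ *: _).
by field; rewrite C1 M0.
Qed.

(** * Multiplying ordered monomials by the three summands of t *)

(** The slot [h] is left arbitrary so that X, Y, Z and [Ki^2] Z are handled together, by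
    linearity. *)
Definition pbw (a : nat) (h : A) (z : int) (d : nat) : A := dpow Ec a * h * zpowK z * dpow F d.

Lemma pbw_linear (a : nat) (z : int) (d : nat) (k : R) (h g : A) :
  pbw a (k *: h + g) z d = k *: pbw a h z d + pbw a g z d.
Proof.
rewrite /pbw; move: (dpow Ec a) (zpowK z) (dpow F d) => x y u.
by rewrite mulrDr -scalerAr !mulrDl -!scalerAl.
Qed.

Lemma pbw0 (a : nat) (z : int) (d : nat) : pbw a 0 z d = 0.
Proof. by rewrite /pbw mulr0 !mul0r. Qed.

Lemma pbwZ (a : nat) (z : int) (d : nat) (k : R) (h : A) : pbw a (k *: h) z d = k *: pbw a h z d.
Proof. by rewrite -[k *: h]addr0 pbw_linear pbw0 addr0. Qed.

Lemma pbwB (a : nat) (z : int) (d : nat) (h g : A) : pbw a (h - g) z d = pbw a h z d - pbw a g z d.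
Proof. by rewrite addrC -scaleN1r pbw_linear scaleN1r addrC. Qed.

Lemma Ec_pbw (a : nat) (h : A) (z : int) (d : nat) : Ec * pbw a h z d = qi a.+1 *: pbw a.+1 h z d.
Proof.
rewrite /pbw !mulrA dpowS; move: (dpow Ec a.+1) (zpowK z) (dpow F d) => x y u.
by rewrite -!scalerAl.
Qed.

Lemma Ki_pbw (a : nat) (h : A) (z : int) (d : nat) : GRing.comm Ki h ->
  Ki * pbw a h z d = q ^ (- 2 * a%:Z) *: pbw a h (z - 1) d.
Proof.
move=> Kh; rewrite /pbw !mulrA Ki_dpow -Ki_zpowK.
move: (dpow Ec a) (zpowK z) (dpow F d) => x y u; rewrite -!scalerAl; congr (_ *: (_ * _)).
by rewrite -!mulrA (mulrA Ki h) Kh -mulrA.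
Qed.

(** Raising c by one raises the exponent of K by two; the factor [Ki^2] compensates, so that
    monomials are compared at equal [z]. *)
Lemma KiKi_pbw (a : nat) (h : A) (z : int) (d : nat) : GRing.comm Ki h ->
  pbw a (Ki ^+ 2 * h) z d = pbw a h (z - 2) d.
Proof.
move=> Kh; have KKh : Ki ^+ 2 * h = h * Ki ^+ 2.
  exact: commr_sym (commrX 2 (commr_sym Kh)).
have -> : z - 2 = z - 1 - 1 by lia.
by rewrite /pbw KKh -!Ki_zpowK expr2 !mulrA.
Qed.

Definition F_pbw_lower (a : nat) (h : A) (z : int) (d : nat) : A :=
  if a is a'.+1 then
    w *: (q ^ (- 3 * a'%:Z) *: pbw a' (Ki ^+ 2 * h) z d - q ^ (- a'%:Z) *: pbw a' h z d)
  else 0.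

(** F either travels through all factors and raises the power of F, or is consumed by one [Ec],
    which gives the lower term. *)
Lemma F_pbw (a : nat) (h h' : A) (z : int) (d : nat) : F * h = h' * F ->
  F * pbw a h z d = (q ^ (- 2 * a%:Z + 2 * z) * qi d.+1) *: pbw a h' z d.+1 + F_pbw_lower a h z d.
Proof.
move=> Fh.
have -> : F * pbw a h z d = F * dpow Ec a * h * zpowK z * dpow F d by rewrite /pbw !mulrA.
rewrite F_dpow 3![in LHS]mulrDl; congr (_ + _).
  have Fx x : F * h * zpowK z * x = q ^ (2 * z) *: (h' * zpowK z * (F * x)).
    by rewrite Fh -(mulrA h') F_zpowK -!scalerAr -!scalerAl !mulrA.
  have -> : (q ^ (- 2 * a%:Z + 2 * z) * qi d.+1) *: pbw a h' z d.+1
      = q ^ (- 2 * a%:Z) *: (q ^ (2 * z) *: (dpow Ec a * (h' * zpowK z * (F * dpow F d)))).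
    rewrite expzD // dpowS /pbw; move: (dpow Ec a) (dpow F d.+1) => x u.
    by rewrite -!scalerAr !scalerA !mulrA.
  move: (dpow Ec a) (dpow F d) Fx => x u Fx.
  by rewrite (scalerAr (q ^ (2 * z)) x) -Fx -!scalerAl !mulrA.
case: a => [|a] /=; first by rewrite !mul0r.
rewrite /pbw; move: (dpow Ec a) (dpow F d) => x u.
rewrite -scalerAr -!scalerAl; congr (_ *: _).
by rewrite mulrBr -!scalerAr mulr1 !mulrBl -!scalerAl !mulrA.
Qed.

(** * Multiplication of the expansion by t *)

Variables (p : int -> R) (kappa : R).
Hypotheses (p_neg : forall k : nat, p (Negz k) = 0)
  (p_rec : forall k : int, kappa * p k =
    qi (k + 1) * p (k + 1) - q ^ (2 - 2 * k) * qi (k - 2) * p (k - 1)).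
Let t : A := F + Ec + kappa *: Ki.

(** The exponent of K, equal to b - n + 2c with b = a + d. Its negative is the index of [p], so
    terms with a positive exponent vanish; this gives all upper boundary conditions. *)
Definition zexp (n : int) (a d c : nat) : int := a%:Z + d%:Z + 2 * c%:Z - n.

(** [n] and [m] are kept independent so that one computation serves n = 2m with [s] = 1 and n = 2m+1
    with [s] = -1. *)
Definition expansion_term (s n : int) (m a d c : nat) : A :=
  (q ^ expo s n a d c * p (- zexp n a d c)) *:
    pbw a (hbin (1 - m%:Z) c) (zexp n a d c) d.

Definition expansion (s n : int) (m B : nat) : A := sum3 A B (expansion_term s n m).

Definition product_term (s n : int) (m a d c : nat) : A :=
  let v h := pbw a h (zexp (n + 1) a d c) d in
  p (- zexp (n + 1) a d c) *:
   (prod_coefX q s n a d c *: v (hbin (1 - m%:Z) c) + prod_coefY q s n a d c *: v (hbin (- m%:Z) c)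
    + prod_coefW q s n a d c *: v (Ki ^+ 2 * hprev (1 - m%:Z) c)
    + prod_coefZ q s n a d c *: v (hprev (1 - m%:Z) c)).

Lemma p_lt0 (k : int) : k < 0 -> p k = 0.
Proof. by case: k. Qed.

Lemma Ki_hbin (a : int) (c : nat) : GRing.comm Ki (hbin a c).
Proof. exact: hbin_comm. Qed.

(** [Ec] raises a, so a is shifted; the new boundary term at a = 0 vanishes because [0] = 0. *)
Lemma Ec_expansion (s : int) (n m B : nat) : (n.+1 < B)%N ->
  Ec * expansion s n m B = sum3 A B (fun a d c =>
    (p (- zexp (n.+1) a d c) * (qi a * q ^ expo s n (a%:Z - 1) d c)) *:
      pbw a (hbin (1 - m%:Z) c) (zexp n.+1 a d c) d).
Proof.
move=> nB; rewrite -sum3_shift_a; first last.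
- by move=> d c; rewrite p_lt0 ?mul0r ?scale0r // /zexp; lia.
- by move=> d c; rewrite qi0 mul0r mulr0 scale0r.
rewrite /expansion /sum3 mulr_sumr; apply: eq_bigr => a _.
rewrite mulr_sumr; apply: eq_bigr => d _; rewrite mulr_sumr; apply: eq_bigr => c _.
rewrite /expansion_term -scalerAr Ec_pbw scalerA.
have -> : zexp n.+1 a.+1 d c = zexp n a d c by rewrite /zexp; lia.
have -> : a.+1%:Z - 1 = a by lia.
by congr (_ *: _); rewrite -mulrA mulrC -mulrA; congr (_ * _); rewrite mulrC.
Qed.

Lemma mulr_sum3 (x : A) (B : nat) (f : nat -> nat -> nat -> A) :
  x * sum3 A B f = sum3 A B (fun a d c => x * f a d c).
Proof. by rewrite /sum3 !mulr_sumr; do 2!(apply: eq_bigr => ? _; rewrite !mulr_sumr). Qed.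

Lemma Fupper_expansion (s : int) (n m B : nat) : (n.+1 < B)%N ->
  sum3 A B (fun a d c => (q ^ expo s n a d c * p (- zexp n a d c)) *:
     ((q ^ (- 2 * a%:Z + 2 * zexp n a d c) * qi d.+1)
        *: pbw a (hbin (- m%:Z) c) (zexp n a d c) d.+1))
  = sum3 A B (fun a d c => (p (- zexp n.+1 a d c) * prod_coefY q s n a d c) *:
      pbw a (hbin (- m%:Z) c) (zexp n.+1 a d c) d).
Proof.
move=> nB; rewrite -[RHS]sum3_shift_d; first last.
- by move=> a c; rewrite p_lt0 ?mul0r ?scale0r // /zexp; lia.
- by move=> a c; rewrite /prod_coefY -/(qi _) qi0 !mul0r mulr0 scale0r.
apply: eq_sum3 => a d c; rewrite scalerA.
have -> : zexp n.+1 a d.+1 c = zexp n a d c by rewrite /zexp; lia.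
rewrite /prod_coefY -/(qi _).
have -> : d.+1%:Z - 1 = d by lia.
have -> : - 2 * a%:Z + 2 * (a%:Z + d.+1%:Z + 2 * c%:Z - n%:Z - 1) = - 2 * a%:Z + 2 * zexp n a d c.
  by rewrite /zexp; lia.
congr (_ *: _); move: (q ^ _) (q ^ _) (p _) (qi _) => x y u k.
by ring.
Qed.

(** The lower term loses one [Ec]. At index n+1 this matches the exponent of K for c+1, so a is
    shifted on the left and c on the right, and the h-factor becomes [hprev]. *)
Lemma Flower_expansion (s : int) (n m B : nat) : (n.+1 < B)%N ->
  sum3 A B (fun a d c => (q ^ expo s n a d c * p (- zexp n a d c)) *:
     F_pbw_lower a (hbin (1 - m%:Z) c) (zexp n a d c) d)
  = sum3 A B (fun a d c => (p (- zexp n.+1 a d c) * (w * q ^ expo s n (a%:Z + 1) d (c%:Z - 1))) *: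
     (q ^ (- 3 * a%:Z) *: pbw a (Ki ^+ 2 * hprev (1 - m%:Z) c) (zexp n.+1 a d c) d
      - q ^ (- a%:Z) *: pbw a (hprev (1 - m%:Z) c) (zexp n.+1 a d c) d)).
Proof.
move=> nB; rewrite -[LHS]sum3_shift_a; first last.
- by move=> d c; rewrite p_lt0 ?mulr0 ?scale0r // /zexp; lia.
- by move=> d c; rewrite scaler0.
rewrite -[RHS]sum3_shift_c; first last.
- by move=> a d; rewrite p_lt0 ?mul0r ?scale0r // /zexp; lia.
- by move=> a d; rewrite /= mulr0 pbw0 !scaler0 subr0 scaler0.
apply: eq_sum3 => a d c; rewrite /F_pbw_lower scalerA.
have -> : zexp n.+1 a d c.+1 = zexp n a.+1 d c by rewrite /zexp; lia.
have -> : a%:Z + 1 = a.+1 by lia.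
have -> : c.+1%:Z - 1 = c by lia.
by congr (_ *: _); rewrite mulrAC mulrC [w * _]mulrC.
Qed.

(** [p_rec] splits each term in two: the value of index k+1 stays at c, the value of index k-1
    belongs to c+1 and acquires [Ki^2]. *)
Lemma Ki_expansion (s : int) (n m B : nat) : (n.+1 < B)%N ->
  kappa *: (Ki * expansion s n m B) = sum3 A B (fun a d c =>
    (p (- zexp n.+1 a d c) * (q ^ (- 2 * a%:Z) * q ^ expo s n a d c
       * qi (n%:Z + 1 - a%:Z - d%:Z - 2 * c%:Z))) *:
      pbw a (hbin (1 - m%:Z) c) (zexp n.+1 a d c) d)
   - sum3 A B (fun a d c =>
    (p (- zexp n.+1 a d c) * (q ^ (- 2 * a%:Z) * q ^ expo s n a d (c%:Z - 1)
       * q ^ (2 - 2 * (n%:Z - a%:Z - d%:Z - 2 * c%:Z + 2))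
       * qi (n%:Z - a%:Z - d%:Z - 2 * c%:Z))) *:
      pbw a (Ki ^+ 2 * hprev (1 - m%:Z) c) (zexp n.+1 a d c) d).
Proof.
move=> nB; rewrite scalerAl mulr_sum3.
rewrite -[X in _ = _ - X]sum3_shift_c; first last.
- by move=> a d; rewrite p_lt0 ?mul0r ?scale0r // /zexp; lia.
- by move=> a d; rewrite /= [Ki ^+ 2 * _]mulr0 pbw0 scaler0.
(* The second sum is added and subtracted, which reduces the claim to an identity of single
   terms. *)
rewrite -[LHS]addr0 -[X in _ + X](subrr (sum3 A B (fun a d c =>
    (p (- zexp n.+1 a d c.+1) * (q ^ (- 2 * a%:Z) * q ^ expo s n a d (c.+1%:Z - 1)
       * q ^ (2 - 2 * (n%:Z - a%:Z - d%:Z - 2 * c.+1%:Z + 2))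
       * qi (n%:Z - a%:Z - d%:Z - 2 * c.+1%:Z))) *:
      pbw a (Ki ^+ 2 * hprev (1 - m%:Z) c.+1) (zexp n.+1 a d c.+1) d))).
rewrite addrA -sum3D; congr (_ - _); apply: eq_sum3 => a d c.
rewrite /expansion_term -scalerAl -scalerAr (Ki_pbw _ _ _ _ (Ki_hbin _ _)) /=.
rewrite (KiKi_pbw _ _ _ _ (Ki_hbin _ _)).
have -> : zexp n.+1 a d c.+1 - 2 = zexp n a d c - 1 by rewrite /zexp; lia.
have -> : zexp n.+1 a d c.+1 = zexp n a d c + 1 by rewrite /zexp; lia.
have -> : zexp n.+1 a d c = zexp n a d c - 1 by rewrite /zexp; lia.
have -> : c.+1%:Z - 1 = c by lia.
rewrite !scalerA -scalerDl; congr (_ *: _).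
have -> : n%:Z - a%:Z - d%:Z - 2 * c.+1%:Z + 2 = - zexp n a d c by rewrite /zexp; lia.
have -> : n%:Z - a%:Z - d%:Z - 2 * c.+1%:Z = - zexp n a d c - 2 by rewrite /zexp; lia.
have -> : n%:Z + 1 - a%:Z - d%:Z - 2 * c%:Z = - zexp n a d c + 1 by rewrite /zexp; lia.
have -> : - (zexp n a d c - 1) = - zexp n a d c + 1 by lia.
have -> : - (zexp n a d c + 1) = - zexp n a d c - 1 by lia.
rewrite [kappa * (_ * _)]mulrCA p_rec.
move: (q ^ (- 2 * a%:Z)) (q ^ expo s n a d c) (q ^ (2 - 2 * - zexp n a d c)) => x y z.
move: (p _) (p (- zexp n a d c - 1)) (qi _) (qi (- zexp n a d c - 2)) => u1 u2 k1 k2.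
by ring.
Qed.

Lemma t_expansion (s : int) (n m B : nat) : (n.+1 < B)%N ->
  t * expansion s n m B = sum3 A B (product_term s n m).
Proof.
move=> nB; rewrite /t !mulrDl -scalerAl Ki_expansion // Ec_expansion //.
have -> : F * expansion s n m B = sum3 A B (fun a d c =>
   (p (- zexp n.+1 a d c) * prod_coefY q s n a d c) *:
      pbw a (hbin (- m%:Z) c) (zexp n.+1 a d c) d) +
   sum3 A B (fun a d c => (p (- zexp n.+1 a d c) * (w * q ^ expo s n (a%:Z + 1) d (c%:Z - 1))) *:
     (q ^ (- 3 * a%:Z) *: pbw a (Ki ^+ 2 * hprev (1 - m%:Z) c) (zexp n.+1 a d c) d
      - q ^ (- a%:Z) *: pbw a (hprev (1 - m%:Z) c) (zexp n.+1 a d c) d)).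
  rewrite -Fupper_expansion // -Flower_expansion // -sum3D mulr_sum3.
  apply: eq_sum3 => a d c; rewrite /expansion_term -scalerAr -scalerDr; congr (_ *: _).
  by apply: F_pbw; rewrite F_hbin; congr (hbin _ _ * _); lia.
(* The subtracted sum of [Ki_expansion] goes to the right, so that both sides can be compared term
   by term. *)
apply/eqP; rewrite addrA subr_eq -!sum3D; apply/eqP; apply: eq_sum3 => a d c.
rewrite /product_term.
have -> : n%:Z + 1 = n.+1 by lia.
move: (pbw a _ _ d) (pbw a _ _ d) (pbw a _ _ d) (pbw a _ _ d) => v1 v2 v3 v4.
rewrite -!(scalerA (p _)) -!(scalerDr (p _)); congr (_ *: _).
rewrite /prod_coefX /prod_coefW /prod_coefZ -!/(qi _) -/w.
have -> : n.+1%:Z - a%:Z = n%:Z + 1 - a%:Z by lia.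
exact: collect_terms.
Qed.

Lemma t_expansion_even (m B : nat) : ((2 * m).+1 < B)%N ->
  t * expansion 1 (2 * m)%N m B = qi (2 * m).+1 *: expansion (- 1) (2 * m).+1 m B.
Proof.
move=> mB; rewrite t_expansion // /expansion /sum3 scaler_sumr.
apply: eq_bigr => a _; rewrite scaler_sumr; apply: eq_bigr => d _.
rewrite scaler_sumr; apply: eq_bigr => c _; rewrite /product_term.
have [-> ->] := hbin_rec m c.
have := even_coefX R q q_neq0 (q_nroot 1) a d c m.
have := even_coefY R q q_neq0 (q_nroot 1) a d c m.
cbv zeta; have -> : 2 * m%:Z = (2 * m)%N by lia.
have -> : (2 * m)%N%:Z + 1 = (2 * m).+1 by lia.
rewrite -!/(qi _) => hY hX.
rewrite pbwZ !pbwB pbwZ eliminate_terms hX hY scale0r addr0 /expansion_term !scalerA.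
by congr (_ *: _); rewrite mulrC mulrA.
Qed.

Lemma t_expansion_odd (m B : nat) : ((2 * m).+2 < B)%N ->
  t * expansion (- 1) (2 * m).+1 m B = qi (2 * m).+2 *: expansion 1 (2 * m).+2 m.+1 B
    + qi (2 * m).+1 *: expansion 1 (2 * m)%N m B.
Proof.
move=> mB; rewrite t_expansion //.
(* Shifting c by one gives the expansion of index 2m the K-exponents of index 2m+2; the added term
   at c = 0 is zero by the choice of [hprev]. *)
have -> : expansion 1 (2 * m)%N m B = sum3 A B (fun a d c =>
    (q ^ expo 1 (2 * m)%N a d (c%:Z - 1) * p (- zexp (2 * m).+2 a d c)) *:
    pbw a (hprev (1 - m%:Z) c) (zexp (2 * m).+2 a d c) d).
  rewrite -sum3_shift_c; first last.
  - by move=> a d; rewrite p_lt0 ?mulr0 ?scale0r // /zexp; lia.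
  - by move=> a d; rewrite pbw0 scaler0.
  apply: eq_sum3 => a d c; rewrite /expansion_term.
  have -> : c.+1%:Z - 1 = c by lia.
  by have -> : zexp (2 * m).+2 a d c.+1 = zexp (2 * m)%N a d c by rewrite /zexp; lia.
have scaler_sum3 k f : k *: sum3 A B f = sum3 A B (fun a d c => k *: f a d c).
  by rewrite /sum3 !scaler_sumr; do 2!(apply: eq_bigr => ? _; rewrite !scaler_sumr).
rewrite /expansion !scaler_sum3 -sum3D; apply: eq_sum3 => a d c.
rewrite /product_term /expansion_term.
have [-> ->] := hbin_rec m c.
have := odd_coefX R q q_neq0 (q_nroot 1) a d c m.
have := odd_coefY R q q_neq0 (q_nroot 1) a d c m.
cbv zeta; have -> : 2 * m%:Z + 1 = (2 * m).+1 by lia.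
have -> : (2 * m).+1%:Z + 1 = (2 * m).+2 by lia.
have -> : (2 * m).+1%:Z - 1 = (2 * m)%N by lia.
have -> : 1 - m.+1%:Z = - m%:Z by lia.
rewrite -!/(qi _) => hY hX.
rewrite pbwZ !pbwB pbwZ eliminate_terms hX hY.
move: (p _) (pbw a _ _ d) (pbw a _ _ d) => u v1 v2.
move: (qi (2 * m).+1) (qi _) (q ^ expo 1 (2 * m)%N a d (c%:Z - 1)) => k1 k2 x.
move: (q ^ expo 1 (2 * m).+2 a d c) (q ^ (4 * c%:Z)) => y l.
rewrite scalerBl scalerDr !scalerBr addrCA !scalerA.
by congr (_ *: _ + (_ *: _ - _ *: _)); ring.
Qed.

(** * Recursion for the products of factors t - [2j-1] *)

Definition tprod (m : nat) : A :=
  \prod_(i < (2 * m)%N) (t - (qi (2 * ((i%:Z) - m%:Z + 1) - 1))%:A).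
Definition tdot_even (m : nat) : A := (qfact (2 * m))^-1 *: tprod m.
Definition tdot_odd (m : nat) : A := (qfact (2 * m).+1)^-1 *: (t * tprod m).

Lemma qiN (n : int) : qi (- n) = - qi n.
Proof. by rewrite /qi opprK -mulNr opprB. Qed.

(** The two new factors, at the ends of the product, are t + [2m+1] and t - [2m+1]; all factors
    commute with t. *)
Lemma tprodS (m : nat) :
  tprod m.+1 = t * (t * tprod m) - (qi (2 * m).+1 ^+ 2) *: tprod m.
Proof.
have comm_t x k : GRing.comm x t -> GRing.comm x (t - k%:A).
  by move=> xt; rewrite /GRing.comm mulrBr mulrBl xt -scalerAl -scalerAr mulr1 mul1r.
have comm_prod : GRing.comm t (tprod m) by apply: commr_prod => i _; apply: comm_t.
rewrite /tprod [(2 * m.+1)%N]mulnS big_ord_recr big_ord_recl /=.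
have -> : 2 * (0%N%:Z - m.+1%:Z + 1) - 1 = - (2 * m).+1%:Z by lia.
have -> : 2 * ((2 * m).+1%:Z - m.+1%:Z + 1) - 1 = (2 * m).+1 by lia.
rewrite qiN.
have -> : \prod_(i < 2 * m) (t - (qi (2 * ((lift ord0 i)%:Z - m.+1%:Z + 1) - 1))%:A) = tprod m.
  by apply: eq_bigr => i _; rewrite lift0; congr (_ - (qi _)%:A); lia.
move: (qi _) => k; rewrite -mulrA (comm_t _ k (commr_sym comm_prod)).
rewrite scaleNr opprK mulrBl -scalerAl mul1r.
by rewrite mulrDl mulrBr -scalerAl mul1r -scalerAr scalerBr scalerA addrA subrK.
Qed.

Lemma t_tdot_even (m : nat) : t * tdot_even m = qi (2 * m).+1 *: tdot_odd m.
Proof.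
rewrite /tdot_even /tdot_odd -scalerAr scalerA qfactS invfM mulrCA.
by rewrite divff ?mulr1 // qiS_neq0.
Qed.

Lemma t_tdot_odd (m : nat) :
  t * tdot_odd m = qi (2 * m).+2 *: tdot_even m.+1 + qi (2 * m).+1 *: tdot_even m.
Proof.
rewrite /tdot_even /tdot_odd -scalerAr mulnS add2n tprodS.
move: (t * (t * tprod m)) (tprod m) => v1 v2; rewrite !qfactS.
move: (qfact_neq0 (2 * m)) (qiS_neq0 (2 * m)) (qiS_neq0 (2 * m).+1).
move: (qfact _) (qi _) (qi _) => f k1 k2 f0 k10 k20.
rewrite scalerBr scalerBr !scalerA -addrA -scaleNr -scalerDl.
rewrite [X in _ + X *: _](_ : _ = 0) ?scale0r ?addr0.
  by congr (_ *: _); field; rewrite ?f0 ?k10 ?k20.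
by field; rewrite ?f0 ?k10 ?k20.
Qed.

(** * Induction on m and return to triangular sums *)

Hypothesis p_0 : p 0 = 1.

(** Both sides obey the same recursion, and the leading factors [2m+1] and [2m+2] are nonzero and
    cancel. [B] is quantified so that consecutive expansions can be taken over one common cube. *)
Lemma tdot_expansion (m : nat) :
  (forall B, (2 * m < B)%N -> tdot_even m = expansion 1 (2 * m)%N m B) /\
  (forall B, ((2 * m).+1 < B)%N -> tdot_odd m = expansion (- 1) (2 * m).+1 m B).
Proof.
have even_odd k : (forall B, (2 * k < B)%N -> tdot_even k = expansion 1 (2 * k)%N k B) ->
    forall B, ((2 * k).+1 < B)%N -> tdot_odd k = expansion (- 1) (2 * k).+1 k B.
  move=> ev B kB; apply: (scalerI (qiS_neq0 (2 * k))).
  by rewrite -t_tdot_even -t_expansion_even // -ev //; apply: ltnW.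
elim: m => [|m [ev od]].
  suff ev : forall B, (2 * 0 < B)%N -> tdot_even 0 = expansion 1 (2 * 0)%N 0 B.
    by split; last exact: even_odd.
  case=> // B _; rewrite /tdot_even /tprod big_ord0 /qfact big_ord0 invr1 scale1r.
  rewrite /expansion (@sum3_triangle A B.+1 1) //; last first.
    by move=> a d c h; rewrite /expansion_term p_lt0 ?mulr0 ?scale0r // /zexp; lia.
  (* For n = 0 any b > 0 makes the index of [p] negative, so only a = d = c = 0 remains. *)
  rewrite big_ord_recl [X in _ + X]big1 ?addr0; last first.
    move=> b _; apply: big1 => a _; apply: big1 => c _.
    by rewrite /expansion_term p_lt0 ?mulr0 ?scale0r // /zexp;
      have := ltn_ord a; have := lift0 b; lia.
  rewrite !big_ord1 /expansion_term /pbw /dpow /qfact /hbin !big_ord0 !expr0 invr1 !scale1r.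
  by rewrite p_0 !mulr1 expr0z scale1r.
suff ev' : forall B, (2 * m.+1 < B)%N -> tdot_even m.+1 = expansion 1 (2 * m.+1)%N m.+1 B.
  by split; last exact: even_odd.
rewrite mulnS add2n => B mB; apply: (scalerI (qiS_neq0 (2 * m).+1)).
apply: (addIr (qi (2 * m).+1 *: tdot_even m)).
rewrite -t_tdot_odd (ev B) ?(od B); last 2 first.
- exact: ltnW.
- by apply: ltnW; apply: ltnW.
by rewrite -t_expansion_odd.
Qed.

(** If c > m then n < 2m+2 makes n - b - 2c negative, so c may stop at m; [m <= n] keeps this range
    inside the cube. *)
Lemma expansion_triangle (s : int) (n m : nat) : (m <= n < (2 * m).+2)%N ->
  expansion s n m n.+1 = \sum_(b < n.+1) \sum_(a < b.+1) \sum_(c < m.+1)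
    (q ^ (2 * c%:Z * c%:Z + s * c%:Z - b%:Z * (n%:Z - b%:Z - 2 * c%:Z) - a%:Z * (b%:Z - a%:Z))
      * p (n%:Z - b%:Z - 2 * c%:Z)) *:
    (dpow Ec a * hbin (1 - m%:Z) c * zpowK (b%:Z - n%:Z + 2 * c%:Z) * dpow F (b - a)).
Proof using q_neq0 p_neg.
move=> mn; rewrite /expansion.
rewrite (@sum3_triangle A _ m.+1); first last.
- by move=> a d c h; rewrite /expansion_term p_lt0 ?mulr0 ?scale0r // /zexp; lia.
- by lia.
apply: eq_bigr => b _; apply: eq_bigr => a _; apply: eq_bigr => c _.
have ab : (b - a)%N%:Z = b%:Z - a%:Z by have := ltn_ord a; lia.
rewrite /expansion_term /pbw /zexp /expo ab.
have -> : a%:Z + (b%:Z - a%:Z) = b by lia.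
have -> : b%:Z + 2 * c%:Z - n%:Z = b%:Z - n%:Z + 2 * c%:Z by lia.
by have -> : - (b%:Z - n%:Z + 2 * c%:Z) = n%:Z - b%:Z - 2 * c%:Z by lia.
Qed.

End NormalOrder.

(** The sums over c >= 0 are written up to c = m: beyond it the index of [U_pdiv] is negative in
    both formulas. *)
Theorem theorem4p5 (A : algType QQq) (E F K Ki : A) (l : int) (m : nat) :
  K * Ki = 1 -> Ki * K = 1 ->
  E * F - F * E = (qq - qq^-1)^-1 *: (K - Ki) ->
  K * E = qq ^+ 2 *: (E * K) ->
  K * F = qq ^- 2 *: (F * K) ->
  let kappa := U_qint (2 * l - 1) in
  let Ec := qq^-1 *: (E * Ki) in
  let t := F + Ec + kappa *: Ki in
  U_tdot_even t m =
    \sum_(b < (2 * m).+1) \sum_(a < b.+1) \sum_(c < m.+1)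
      (qq ^ ((Posz 'C(2 * c, 2)%N) + 2 * c%:Z - b%:Z * (2 * m%:Z - b%:Z - 2 * c%:Z)
              - a%:Z * (b%:Z - a%:Z))
        * U_pdiv (2 * m%:Z - b%:Z - 2 * c%:Z) kappa) *:
      (U_dpow Ec a * U_hbin Ki (1 - m%:Z) c
         * U_zpowK K Ki (b%:Z - 2 * m%:Z + 2 * c%:Z) * U_dpow F (b - a))
  /\
  U_tdot_odd t m =
    \sum_(b < (2 * m).+2) \sum_(a < b.+1) \sum_(c < m.+1)
      (qq ^ ((Posz 'C(2 * c, 2)%N) - b%:Z * (2 * m%:Z - b%:Z - 2 * c%:Z + 1)
              - a%:Z * (b%:Z - a%:Z))
        * U_pdiv (2 * m%:Z - b%:Z - 2 * c%:Z + 1) kappa) *: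
      (U_dpow Ec a * U_hbin Ki (1 - m%:Z) c
         * U_zpowK K Ki (b%:Z - 2 * m%:Z + 2 * c%:Z - 1) * U_dpow F (b - a)).
Proof.
move=> KKi KiK EF KE KF kappa Ec t.
have [ev od] := tdot_expansion QQq qq qq_neq0 qq_expr_neq1 A Ec F K Ki KiK
  (F_K _ _ qq_neq0 A F K KF) (F_Ki _ _ qq_neq0 A F K Ki KKi KiK KF)
  (Ki_Ec _ _ qq_neq0 A E K Ki KKi KiK KE)
  (F_Ec _ _ qq_neq0 A E F K Ki KKi KiK EF KF)
  (fun k => U_pdiv k kappa) kappa (fun k => erefl) (fun k => U_pdiv_rec k kappa)
  (U_pdiv0 kappa) m.
pose P k := U_pdiv k kappa.
have triangle := expansion_triangle QQq qq qq_neq0 A Ec F K Ki P (fun k => erefl).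
(* With this value, the exponents 'C(2c, 2) + 2c and 'C(2c, 2) are 2c^2 + [s] c for [s] = 1 and [s]
   = -1. *)
have binE (c : nat) : 'C(2 * c, 2)%N%:Z = 2 * c%:Z * c%:Z - c%:Z.
  by rewrite bin2 mul2n -doubleMl doubleK; nia.
split.
  transitivity (expansion QQq qq A Ec F K Ki P 1 (2 * m)%N m (2 * m).+1).
    exact: (ev _ (ltnSn _)).
  rewrite triangle; last by lia.
  apply: eq_bigr => b _; apply: eq_bigr => a _; apply: eq_bigr => c _.
  have -> : (2 * m)%N%:Z = 2 * m%:Z by lia.
  congr (_ *: _); congr (qq ^ _ * _).
  by rewrite binE; lia.
transitivity (expansion QQq qq A Ec F K Ki P (- 1) (2 * m).+1 m (2 * m).+2).
  exact: (od _ (ltnSn _)).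
rewrite triangle; last by lia.
apply: eq_bigr => b _; apply: eq_bigr => a _; apply: eq_bigr => c _.
have -> : (2 * m).+1%:Z - b%:Z - 2 * c%:Z = 2 * m%:Z - b%:Z - 2 * c%:Z + 1 by lia.
have -> : b%:Z - (2 * m).+1%:Z + 2 * c%:Z = b%:Z - 2 * m%:Z + 2 * c%:Z - 1 by lia.
congr (_ *: _); congr (qq ^ _ * _).
by rewrite binE; lia.
Qed.
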